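(* Let $J$ be a finite nonempty set and let $\mathscr{S}$ be a family of $d=|\mathscr{S}|\ge 1$ subsets of $J$ that covers $J$. If $\mathscr{S}$ is irredundant, then any binary MIP formulation for $\operatorname{CDC}(\mathscr{S})$ must have at least $\lceil\log_2(d)\rceil$ auxiliary binary variables.
   Context: $\Delta^J=\{\lambda\in\mathbb{R}^J_{\ge 0}:\sum_{v\in J}\lambda_v=1\}$. For $S\subseteq J$, $Q(S)=\{\lambda\in\Delta^J:\lambda_v\le 0\ \forall v\in J\setminus S\}$, and $\operatorname{CDC}(\mathscr{S})=\bigcup_{S\in\mathscr{S}}Q(S)\subseteq\mathbb{R}^J$. $\mathscr{S}$ covers $J$ if $\bigcup_{S\in\mathscr{S}}S=J$, and is irredundant if there are no distinct $S,T\in\mathscr{S}$ with $S\subseteq T$. A binary MIP formulation for a set $Q\subseteq\mathbb{R}^{n_1}$ is a set $F=R\cap(\mathbb{R}^{n_1}\times\mathbb{R}^{n_2}\times\{0,1\}^{n_3})$ with $\operatorname{Proj}_x(F)=Q$, where $$R=\{(x,y,z)\in[l^x,u^x]\times[l^y,u^y]\times[0,1]^{n_3}:Ax+By+Cz\le c\}$$ is given by finitely many linear inequalities (the bounds $l^x,u^x,l^y,u^y$ may take infinite values) and is line-free. Its number of auxiliary binary variables is $n_3$. *)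

(* Defs.v *)
From HB Require Import structures.
From mathcomp Require Import all_boot all_order all_algebra.
From mathcomp Require Import classical_sets reals constructive_ereal.

Set Implicit Arguments.
Unset Strict Implicit.
Unset Printing Implicit Defensive.

Import Order.TTheory GRing.Theory Num.Theory.
Local Open Scope classical_set_scope.
Local Open Scope ring_scope.

Section CDC.
Variables (R : realType) (J : finType).

(* R^J is represented by column vectors of length #|J|, with the coordinate
   of index v : J stored in row enum_rank v. *)
Definition coordJ (x : 'cV[R]_#|J|) (v : J) : R := x (enum_rank v) 0.

Definition simplex : set 'cV[R]_#|J| :=
  [set x | (forall v, 0 <= coordJ x v) /\ \sum_v coordJ x v = 1].

Definition face (S : {set J}) : set 'cV[R]_#|J| :=
  [set x | simplex x /\ forall v, v \in ~: S -> coordJ x v <= 0].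

Definition CDC (SS : {set {set J}}) : set 'cV[R]_#|J| :=
  \bigcup_(S in [set S | S \in SS]) face S.

End CDC.

Arguments CDC R {J} SS _.

Section Families.
Variable J : finType.

Definition covers (SS : {set {set J}}) : Prop :=
  (\bigcup_(S in SS) S)%SET = [set: J]%SET.

Definition irredundant (SS : {set {set J}}) : Prop :=
  ~ exists S T : {set J},
      [/\ S \in SS, T \in SS, S <> T & S \subset T].

End Families.

Section MIP.
Variables (R : realType) (n1 n2 n3 : nat).

Definition box (n : nat) (l u : 'cV[\bar R]_n) : set 'cV[R]_n :=
  [set x : 'cV[R]_n | forall i, (l i ord0 <= (x i ord0)%:E <= u i ord0)%E].

Definition unit_cube : set 'cV[R]_n3 :=
  [set z : 'cV[R]_n3 | forall i, 0 <= z i 0 <= 1].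

Definition binary : set 'cV[R]_n3 :=
  [set z : 'cV[R]_n3 | forall i, z i 0 = 0 \/ z i 0 = 1].

Definition relaxation (m : nat)
    (lx ux : 'cV[\bar R]_n1) (ly uy : 'cV[\bar R]_n2)
    (A : 'M[R]_(m, n1)) (B : 'M[R]_(m, n2)) (C : 'M[R]_(m, n3))
    (c : 'cV[R]_m) : set ('cV[R]_n1 * 'cV[R]_n2 * 'cV[R]_n3) :=
  [set p | let: (x, y, z) := p in
     [/\ box lx ux x, box ly uy y, unit_cube z &
         forall k, (A *m x + B *m y + C *m z) k 0 <= c k 0]].

Definition line_free (P : set ('cV[R]_n1 * 'cV[R]_n2 * 'cV[R]_n3)) : Prop :=
  ~ exists p d : 'cV[R]_n1 * 'cV[R]_n2 * 'cV[R]_n3,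
      d <> 0 /\ forall t : R, P (p + t *: d).

Definition proj_x (F : set ('cV[R]_n1 * 'cV[R]_n2 * 'cV[R]_n3)) :
    set 'cV[R]_n1 :=
  [set p.1.1 | p in F].

(* The number of auxiliary binary variables of F is n3, read off its type. *)
Definition binary_MIP_formulation (Q : set 'cV[R]_n1)
    (F : set ('cV[R]_n1 * 'cV[R]_n2 * 'cV[R]_n3)) : Prop :=
  exists (m : nat)
    (lx ux : 'cV[\bar R]_n1) (ly uy : 'cV[\bar R]_n2)
    (A : 'M[R]_(m, n1)) (B : 'M[R]_(m, n2)) (C : 'M[R]_(m, n3))
    (c : 'cV[R]_m),
  let P := relaxation lx ux ly uy A B C c in
  [/\ line_free P,
      F = P `&` [set p | binary p.2] &
      proj_x F = Q].

End MIP.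

(* Main.v *)
Require Import Defs.
From mathcomp Require Import all_boot all_order all_algebra.
From mathcomp Require Import classical_sets reals constructive_ereal.
From mathcomp Require boolp.
From mathcomp Require Import ring lra.

Set Implicit Arguments.
Unset Strict Implicit.
Unset Printing Implicit Defensive.

(** Send each [S] in the family to the binary part of a point of the formulation
    lying above the barycenter of the face of [S].  If two distinct members [S]
    and [T] had the same binary part, the midpoint of the two points would again
    be in the formulation, by convexity of the relaxation, so the midpoint of
    the barycenters would lie in the face of some [U] in the family.  Its
    support is the union of [S] and [T], hence both are contained in [U], which
    contradicts irredundancy.  So the map is injective and [#|SS| <= 2 ^ n3]. *)

Import Order.TTheory GRing.Theory Num.Theory.
Local Open Scope ring_scope.

Section Convexity.
Variables (R : realType) (t : R).
Hypothesis t01 : 0 <= t <= 1.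

Lemma le_conv (a b c d : R) :
  a <= c -> b <= d -> t * a + (1 - t) * b <= t * c + (1 - t) * d.
Proof.
have /andP[t0 t1] := t01; move=> ac bd.
by apply: lerD; apply: ler_wpM2l; rewrite ?subr_ge0.
Qed.

(** Rewriting a constant bound this way lets [le_conv] compare it with a convex combination of
    points. *)
Lemma conv_id (a : R) : a = t * a + (1 - t) * a.
Proof. by ring. Qed.

Lemma box_convex n (l u : 'cV[\bar R]_n) (x y : 'cV[R]_n) :
  box l u x -> box l u y -> box l u (t *: x + (1 - t) *: y).
Proof.
move=> lux luy i; rewrite !mxE.
have /andP[lx xu] := lux i; have /andP[ly yu] := luy i; apply/andP; split.
  (* An infinite bound is either vacuous or contradicts [lx]; only a finite bound [r] needs an
     argument. *)
  case: (l i ord0) lx ly => [r||//]; rewrite ?leNye // !lee_fin => lx ly.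
  by rewrite [leLHS]conv_id le_conv.
case: (u i ord0) xu yu => [r||//]; rewrite ?leey // !lee_fin => xu yu.
by rewrite [leRHS]conv_id le_conv.
Qed.

Lemma unit_cube_convex n (x y : 'cV[R]_n) :
  unit_cube x -> unit_cube y -> unit_cube (t *: x + (1 - t) *: y).
Proof.
move=> cx cy i; have /andP[x0 x1] := cx i; have /andP[y0 y1] := cy i.
by rewrite !mxE [X in X <= _ <= _]conv_id [X in _ <= _ <= X]conv_id !le_conv.
Qed.

Lemma relaxation_convex n1 n2 n3 m (lx ux : 'cV[\bar R]_n1)
    (ly uy : 'cV[\bar R]_n2) (A : 'M[R]_(m, n1)) (B : 'M[R]_(m, n2))
    (C : 'M[R]_(m, n3)) (c : 'cV[R]_m) p q :
  relaxation lx ux ly uy A B C c p -> relaxation lx ux ly uy A B C c q ->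
  relaxation lx ux ly uy A B C c (t *: p + (1 - t) *: q).
Proof.
case: p q => [[x y] z] [[x' y'] z'] [bx by_ cz H] [bx' by' cz' H'].
split; [exact: box_convex|exact: box_convex|exact: unit_cube_convex|move=> k /=].
rewrite [leRHS]conv_id !mulmxDr -!scalemxAr.
apply: le_trans (le_conv (H k) (H' k)).
by rewrite !mxE le_eqVlt; apply/orP; left; apply/eqP; ring.
Qed.

End Convexity.

Section Barycenter.
Variables (R : realType) (J : finType).

Definition barycenter (S : {set J}) : 'cV[R]_#|J| :=
  \col_i (if enum_val i \in S then #|S|%:R^-1 else 0).

Lemma coordJ_barycenter S v :
  coordJ (barycenter S) v = if v \in S then #|S|%:R^-1 else 0.
Proof. by rewrite /coordJ mxE enum_rankK. Qed.

Lemma coordJ_barycenter_ge0 S v : 0 <= coordJ (barycenter S) v.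
Proof. by rewrite coordJ_barycenter; case: ifP; rewrite ?invr_ge0 ?ler0n. Qed.

Lemma coordJ_barycenter_gt0 (S : {set J}) v :
  v \in S -> 0 < coordJ (barycenter S) v.
Proof.
move=> vS; rewrite coordJ_barycenter vS invr_gt0 ltr0n card_gt0.
by apply/set0Pn; exists v.
Qed.

(** For empty [S] the barycenter is the zero vector, which lies outside the simplex. *)
Lemma barycenter_face (S : {set J}) : S != finset.set0 -> face S (barycenter S).
Proof.
move=> S0; split; last first.
  by move=> v; rewrite inE coordJ_barycenter => /negbTE->.
split; first exact: coordJ_barycenter_ge0.
under eq_bigr do rewrite coordJ_barycenter.
rewrite -big_mkcond /= sumr_const -[LHS]mulr_natl divff //.
by rewrite pnatr_eq0 cards_eq0.
Qed.

(** Both weights are positive, so each coordinate in [S] or [T] is positive, while [face U] makes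
    coordinates outside [U] nonpositive. *)
Lemma face_conv_barycenter (S T U : {set J}) (t : R) : 0 < t < 1 ->
  face U (t *: barycenter S + (1 - t) *: barycenter T) -> S :|: T \subset U.
Proof.
case/andP=> t0 t1 [_ HU]; apply/fintype.subsetP => v vST.
apply/negPn/negP => vU; have := HU v.
rewrite inE vU => /(_ isT); apply/negP; rewrite -ltNge.
have -> : coordJ (t *: barycenter S + (1 - t) *: barycenter T) v =
    t * coordJ (barycenter S) v + (1 - t) * coordJ (barycenter T) v.
  by rewrite /coordJ !mxE.
have t1' : 0 < 1 - t by rewrite subr_gt0.
case/finset.setUP: vST => v_in.
  by rewrite ltr_pwDl ?mulr_gt0 ?coordJ_barycenter_gt0 //
     mulr_ge0 ?coordJ_barycenter_ge0 ?ltW.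
by rewrite ltr_wpDl ?mulr_gt0 ?coordJ_barycenter_gt0 //
     mulr_ge0 ?coordJ_barycenter_ge0 ?ltW.
Qed.

End Barycenter.

Lemma irredundantP (J : finType) (SS : {set {set J}}) (S T : {set J}) :
  irredundant SS -> S \in SS -> T \in SS -> S \subset T -> S = T.
Proof.
move=> irr SSS TSS ST; apply/eqP/negPn/negP => /eqP neST.
by apply: irr; exists S, T.
Qed.

(** An empty member would be included in the member covering some [v], hence equal to it. *)
Lemma irredundant_cover_neq0 (J : finType) (SS : {set {set J}}) (S : {set J}) :
  (0 < #|J|)%N -> covers SS -> irredundant SS -> S \in SS -> S != finset.set0.
Proof.
move=> /card_gt0P[v _] cov irr SSS; apply/eqP => S0.
have : v \in (\bigcup_(T in SS) T)%SET by rewrite cov inE.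
case/bigcupP => T TSS vT.
have ST : S = T by apply: (irredundantP irr); rewrite ?S0 ?finset.sub0set -?S0.
by rewrite -ST S0 inE in vT.
Qed.

Lemma binaryP (R : realType) n (z : 'cV[R]_n) :
  binary z -> exists b : {ffun 'I_n -> bool}, z = \col_i (b i)%:R.
Proof.
move=> zb; exists [ffun i => z i 0 == 1]; apply/colP => i.
by rewrite !mxE ffunE; case: (zb i) => ->; rewrite ?eqxx // eq_sym oner_eq0.
Qed.

Local Close Scope ring_scope.

Theorem proposition1 (R : realType) (J : finType) (SS : {set {set J}})
    (J_nonempty : 0 < #|J|) (SS_nonempty : 1 <= #|SS|)
    (SS_covers : covers SS) (SS_irredundant : irredundant SS)
    (n2 n3 : nat)
    (F : set ('cV[R]_#|J| * 'cV[R]_n2 * 'cV[R]_n3))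
    (F_formulation : binary_MIP_formulation (CDC R SS) F) :
  up_log 2 #|SS| <= n3.
Proof.
case: F_formulation => m [lx [ux [ly [uy [A [B [C [c [_ FE FQ]]]]]]]]].
(* The membership hypothesis sits under the existential so that choice yields a total [f]; sets
   outside [SS] get a dummy value. *)
have lift (S : {set J}) : exists b : {ffun 'I_n3 -> bool}, S \in SS ->
    exists y, F (barycenter R S, y, (\col_i (b i)%:R)%R).
  case: (boolP (S \in SS)) => [SSS|_]; last by exists [ffun=> false].
  have : CDC R SS (barycenter R S).
    by exists S => //; apply/barycenter_face/(irredundant_cover_neq0 _ SS_covers).
  rewrite -FQ => -[[[x y] z] Fp /= xE].
  have : binary z by move: Fp; rewrite FE => -[].
  by case/binaryP => b zE; exists b => _; exists y; rewrite -zE -xE.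
have [f fP] := boolp.choice lift.
have f_inj : {in SS &, injective f}.
  move=> S T SSS TSS fST.
  have [y Fp] := fP S SSS; have [y' Fq] := fP T TSS; rewrite -fST in Fq.
  have : CDC R SS (2^-1 *: barycenter R S + (1 - 2^-1) *: barycenter R T)%R.
    rewrite -FQ.
    exists (2^-1 *: (barycenter R S, y, \col_i (f S i)%:R) +
            (1 - 2^-1) *: (barycenter R T, y', \col_i (f S i)%:R))%R => //.
    move: Fp Fq; rewrite FE => -[rp bp] [rq _]; split.
      by apply: relaxation_convex => //; lra.
    (* The two points share their binary part, so the midpoint has the same one and stays binary. *)
    by rewrite /= -scalerDl addrC subrK scale1r.
  case=> U USS /face_conv_barycenter; rewrite finset.subUset => /(_ _)/andP[].
    lra.
  by move=> /(irredundantP SS_irredundant SSS USS)->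
    /(irredundantP SS_irredundant TSS USS)->.
apply: up_log_min => //.
(* The bound [2 ^ n3] becomes the cardinality of the codomain of [f], which contains the image of
   [SS]. *)
rewrite -(card_in_imset f_inj) -[n3 in leqRHS]card_ord -card_bool -card_ffun.
exact: max_card.
Qed.
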